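(* Let $\mathcal{H}$ be a complex Hilbert space and let $A \in \mathcal{B}(\mathcal{H})$. Then $$w^2(A)\geq \frac{1}{4}\left\|A^*A+AA^*\right\|+\frac{c^2(\Re(A))+c^2(\Im(A))}{2}+\left|\frac{\|\Re(A)\|^2-\|\Im(A)\|^2}{2}+\frac{c^2(\Im(A))-c^2(\Re(A))}{2}\right|.$$
   Context: $\mathcal{B}(\mathcal{H})$ denotes the algebra of all bounded linear operators on the complex Hilbert space $\mathcal{H}$, with operator norm $\|\cdot\|$ and adjoint $A^*$. The numerical radius is $w(A)=\sup\{|\langle Ax,x\rangle| : x\in\mathcal{H},\ \|x\|=1\}$ and the Crawford number is $c(A)=\inf\{|\langle Ax,x\rangle| : x\in\mathcal{H},\ \|x\|=1\}$; $w^2(\cdot)$ and $c^2(\cdot)$ denote their squares. The real and imaginary parts are the operators $\Re(A)=\frac{A+A^*}{2}$ and $\Im(A)=\frac{A-A^*}{2\mathrm{i}}$. *)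

(* Defs.v *)
From HB Require Import structures.
From mathcomp Require Import all_boot all_order all_algebra.
From mathcomp Require Import all_classical all_reals all_analysis.
From mathcomp Require Import complex.

Set Implicit Arguments.
Unset Strict Implicit.
Unset Printing Implicit Defensive.

Import Order.TTheory GRing.Theory Num.Theory.
Import numFieldNormedType.Exports.

Local Open Scope classical_set_scope.
Local Open Scope ring_scope.

(* A complex Hilbert space: the inner product is linear in its first argument,
   conjugate-linear in its second one, and induces the norm, for which the
   space is complete. *)
HB.mixin Record CompleteNormedModule_isHilbert (R : realType) H
    of CompleteNormedModule R[i] H := {
  inner : {dot H for (@Num.conj R[i])} ;
  sqr_norm_inner : forall x : H, `|x| ^+ 2 = inner x x
}.

#[short(type="hilbertType")]
HB.structure Definition Hilbert (R : realType) :=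
  { H of CompleteNormedModule_isHilbert R H & CompleteNormedModule R[i] H }.

(* The norm of R[i] and of an R[i]-module takes its values in (the nonnegative
   reals of) R[i]; [rnorm] is the same norm as an element of R. *)
Definition rnorm (R : realType) (V : normedZmodType R[i]) (x : V) : R :=
  complex.Re `|x|.

Section operators.
Context {R : realType} {H : hilbertType R}.
Implicit Types A : H -> H.

Definition bounded_operator A := linear A /\ bounded_near A (nbhs 0).

(* [adjoint A y] is the unique z such that <A x, y> = <x, z> for all x; it
   exists by the Riesz representation theorem when A is bounded. *)
Definition adjoint A : H -> H :=
  fun y => get [set z | forall x, inner (A x) y = inner x z].

Definition re_op A : H -> H := fun x => 2^-1 *: (A x + adjoint A x).

Definition im_op A : H -> H := fun x => (2 * 'i%C)^-1 *: (A x - adjoint A x).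

Definition unit_sphere : set H := [set x | `|x| = 1].

(* When H = 0 the unit sphere is empty and the three quantities below are 0,
   since [sup set0 = 0] and [inf set0 = 0]. *)
Definition op_norm A : R := sup [set rnorm (A x) | x in unit_sphere].

Definition numerical_radius A : R :=
  sup [set rnorm (inner (A x) x) | x in unit_sphere].

Definition crawford_number A : R :=
  inf [set rnorm (inner (A x) x) | x in unit_sphere].

End operators.

(* Main.v *)
From HB Require Import structures.
Require Import Defs.
From mathcomp Require Import all_boot all_order all_algebra.
From mathcomp Require Import all_classical all_reals all_analysis.
From mathcomp Require Import complex.
From mathcomp Require Import ring lra.
Import Order.TTheory GRing.Theory Num.Theory.
Import numFieldNormedType.Exports.
Local Open Scope ring_scope.

(* Write [A = S + i T] with [S], [T] the self-adjoint real and imaginary parts;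
   on a unit vector [|<Ax, x>|^2 = <Sx, x>^2 + <Tx, x>^2], so that
   [<Sx, x>^2 <= w(A)^2 - c(T)^2].  Since the norm of a self-adjoint operator is
   controlled by its quadratic form, [|S|^2 + c(T)^2 <= w(A)^2], and likewise
   with [S] and [T] exchanged.  The larger of these two lower bounds is their
   mean plus half their distance, and [A^*A + AA^* = 2 (S^2 + T^2)] bounds
   [|A^*A + AA^*| / 4] by [(|S|^2 + |T|^2) / 2].  The adjoint exists by the Riesz
   representation theorem, obtained by minimizing [|x|^2 - 2 Re f(x)]. *)

(** * The real inner product underlying the complex one *)

Definition rdot {R : realType} {H : hilbertType R} (x y : H) : R :=
  complex.Re (inner x y).

Section real_inner_product.
Context {R : realType} {H : hilbertType R}.
Implicit Types (x y z : H) (a b c : R).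

Lemma innerZl (k : R[i]) x y : inner (k *: x) y = k * inner x y.
Proof. by rewrite linearZl_LR. Qed.

Lemma innerZr (k : R[i]) x y : inner x (k *: y) = (k^*)%C * inner x y.
Proof. by rewrite linearZr_LR. Qed.

Lemma innerDl x y z : inner (x + y) z = inner x z + inner y z.
Proof. exact: linearDl. Qed.

Lemma innerDr x y z : inner x (y + z) = inner x y + inner x z.
Proof. exact: linearDr. Qed.

Lemma innerBl x y z : inner (x - y) z = inner x z - inner y z.
Proof. exact: linearBl. Qed.

Lemma innerBr x y z : inner x (y - z) = inner x y - inner x z.
Proof. exact: linearBr. Qed.

Lemma innerC x y : inner x y = ((inner y x)^*)%C.
Proof. by rewrite (hermC inner) expr0 mul1r. Qed.

Lemma rdotDl x y z : rdot (x + y) z = rdot x z + rdot y z.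
Proof. by rewrite /rdot innerDl raddfD. Qed.

Lemma rdotDr x y z : rdot x (y + z) = rdot x y + rdot x z.
Proof. by rewrite /rdot innerDr raddfD. Qed.

Lemma rdotBl x y z : rdot (x - y) z = rdot x z - rdot y z.
Proof. by rewrite /rdot innerBl raddfB. Qed.

Lemma rdotBr x y z : rdot x (y - z) = rdot x y - rdot x z.
Proof. by rewrite /rdot innerBr raddfB. Qed.

Lemma rdotC x y : rdot x y = rdot y x.
Proof. by rewrite /rdot innerC; case: (inner y x). Qed.

Lemma rdotZl a x y : rdot (a%:C%C *: x) y = a * rdot x y.
Proof. by rewrite /rdot innerZl; case: (inner x y) => u v /=; rewrite mul0r subr0. Qed.

Lemma rdotZr a x y : rdot x (a%:C%C *: y) = a * rdot x y.
Proof. by rewrite rdotC rdotZl rdotC. Qed.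

(** Recovers the imaginary part from [rdot], so that Riesz representation is only needed for real
    functionals. *)
Lemma Im_inner_l x y : complex.Im (inner x y) = - rdot ('i%C *: x) y.
Proof. by rewrite /rdot innerZl; case: (inner x y) => u v /=; ring. Qed.

Lemma rnormE {V : normedZmodType R[i]} (x : V) : `|x| = (rnorm x)%:C%C.
Proof. by rewrite /rnorm RRe_real// ger0_real. Qed.

Lemma rnorm_ge0 {V : normedZmodType R[i]} (x : V) : 0 <= rnorm x.
Proof. by rewrite -ler0c -rnormE. Qed.

Lemma rnorm_sqr x : rnorm x ^+ 2 = rdot x x.
Proof.
apply: complexI; rewrite rmorphXn /= -rnormE sqr_norm_inner /rdot RRe_real//.
by rewrite -sqr_norm_inner ger0_real// exprn_ge0.
Qed.

Lemma rnormZ (k : R[i]) x : rnorm (k *: x) = rnorm k * rnorm x.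
Proof. by apply: complexI; rewrite rmorphM /= -!rnormE normrZ. Qed.

Lemma rnormD x y : rnorm (x + y) <= rnorm x + rnorm y.
Proof. by rewrite -lecR rmorphD /= -!rnormE ler_normD. Qed.

Lemma rnormB x y : rnorm (x - y) <= rnorm x + rnorm y.
Proof. by rewrite -lecR rmorphD /= -!rnormE ler_normB. Qed.

Lemma rnorm_eq0 x : rnorm x = 0 -> x = 0.
Proof. by move=> x0; apply/normr0_eq0; rewrite rnormE x0. Qed.

Lemma rnorm_real a : rnorm (a%:C%C) = `|a|.
Proof. by rewrite /rnorm normc_def /= expr0n addr0 sqrtr_sqr. Qed.

Lemma rnorm_complex_sqr (k : R[i]) :
  rnorm k ^+ 2 = complex.Re k ^+ 2 + complex.Im k ^+ 2.
Proof. by rewrite /rnorm normc_def /= sqr_sqrtr// addr_ge0 ?sqr_ge0. Qed.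

Lemma rnorm_unit_sphere x : unit_sphere x -> rnorm x = 1.
Proof. by rewrite /unit_sphere /rnorm /= => ->. Qed.

Lemma unit_sphereE x : rnorm x = 1 -> unit_sphere x.
Proof. by rewrite /unit_sphere /= rnormE => ->. Qed.

Lemma normalize_unit_sphere x : x != 0 -> unit_sphere (((rnorm x)^-1)%:C%C *: x).
Proof.
move=> x0; apply: unit_sphereE; rewrite rnormZ rnorm_real.
rewrite ger0_norm ?invr_ge0 ?rnorm_ge0//.
by rewrite mulVf//; apply: contra x0 => /eqP/rnorm_eq0 ->.
Qed.

(** Discriminant criterion for [c + 2 * t * b + t ^+ 2 * a] being nonnegative at all [t]. It gives
    Cauchy-Schwarz, and the near-stationarity of near-minimizers in the Riesz argument. *)
Lemma sqr_le_of_quadratic_ge a b c : 0 <= c ->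
  (forall t, - c <= 2 * t * b + t ^+ 2 * a) -> b ^+ 2 <= c * a.
Proof.
move=> c0 q.
have [b0|b0] := eqVneq b 0.
  rewrite b0 expr0n /= mulr_ge0// leNgt; apply/negP => a0.
  (* When [a < 0], this value of [t] makes [t ^+ 2 * (- a)] exceed [c]. *)
  have := q ((c + 1) / (- a) + 1).
  set u := (c + 1) / - a; rewrite b0 mulr0 add0r => qu.
  have ua : u * (- a) = c + 1 by rewrite /u divfK// oppr_eq0 lt_eqF.
  have u0 : 0 <= u by rewrite /u divr_ge0//; lra.
  have : (u + 1) ^+ 2 * (- a) = (u + 1) * (u * (- a) - a) by ring.
  rewrite ua.
  nra.
have [a0|a0] := leP a 0.
  (* Here the linear term is [- (c + 1)] and the quadratic term is nonpositive. *)
  have := q (- (c + 1) / (2 * b)).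
  set t := _ / _.
  have : t * b * 2 = - (c + 1) by rewrite /t; field.
  nra.
(* The vertex of the parabola. *)
have := q (- b / a).
have -> : 2 * (- b / a) * b + (- b / a) ^+ 2 * a = - (b ^+ 2 / a).
  by field; rewrite gt_eqF.
by rewrite lerN2 ler_pdivrMr.
Qed.

Lemma sqr_rdot_le x y : rdot x y ^+ 2 <= rnorm x ^+ 2 * rnorm y ^+ 2.
Proof.
apply: sqr_le_of_quadratic_ge => [|t]; first exact: sqr_ge0.
have := sqr_ge0 (rnorm (x + t%:C%C *: y)).
rewrite !rnorm_sqr rdotDl !rdotDr !rdotZl !rdotZr (rdotC y x).
lra.
Qed.

Lemma rdot_le x y : `|rdot x y| <= rnorm x * rnorm y.
Proof.
rewrite -ler_sqr ?nnegrE ?mulr_ge0 ?rnorm_ge0//.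
by rewrite real_normK ?num_real// exprMn sqr_rdot_le.
Qed.

Lemma rdot_inj x y : (forall z, rdot z x = rdot z y) -> x = y.
Proof.
move=> e; apply/eqP; rewrite -subr_eq0; apply/eqP/rnorm_eq0/eqP.
by rewrite -sqrf_eq0 rnorm_sqr rdotBr e subrr.
Qed.

End real_inner_product.

(** * Riesz representation by minimization *)

Section riesz.
Local Open Scope classical_set_scope.
Context {R : realType} {H : hilbertType R}.
Implicit Types (x y z : H) (a e : R).

Lemma ball_rnorm x y e : ball x (e%:C%C) y = (rnorm (x - y) < e) :> Prop.
Proof. by rewrite -ball_normE /ball_ /= rnormE ltcR. Qed.

(** If [z] represents [f], then [phi x] is |x - z|^2 - |z|^2, minimal exactly at [z]. So [z] is
    sought as the limit of the filter of near-minimizers of [phi], which is Cauchy. *)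
Lemma riesz_real (f : H -> R) (M : R) :
    (forall x y, f (x + y) = f x + f y) ->
    (forall a x, f (a%:C%C *: x) = a * f x) ->
    (forall x, `|f x| <= M * rnorm x) ->
  exists z, forall x, f x = rdot x z.
Proof.
move=> fD fZ fM.
pose phi x := rnorm x ^+ 2 - 2 * f x.
pose m := inf (range phi).
(* Complete the square in |x|^2 - 2 M |x|. *)
have phi_lb x : - M ^+ 2 <= phi x.
  have := fM x; rewrite ler_norml => /andP[_ fx].
  have := sqr_ge0 (rnorm x - M); rewrite /phi; nra.
have phi_inf : has_inf (range phi).
  split; first by exists (phi 0), 0.
  by exists (- M ^+ 2) => _ [x _ <-].
have m_le x : m <= phi x by apply: ge_inf; [exact: phi_inf.2|exists x].
(* The excess over the infimum is [e ^+ 2] because distances between near-minimizers scale as its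
   square root. *)
pose F := filter_from [set e : R | 0 < e] (fun e => [set x | phi x < m + e ^+ 2]).
have FF : ProperFilter F.
  apply: filter_from_proper; last first.
    move=> e /= e0.
    have [_ [x _ <-] xe] := inf_adherent (exprn_gt0 2 e0) phi_inf.
    by exists x.
  apply: filter_from_filter; first by exists 1 => /=.
  move=> e1 e2 /= e10 e20; exists (Num.min e1 e2); first by rewrite /= lt_min e10.
  have le_sqr (s t : R) : 0 < s -> s <= t -> s ^+ 2 <= t ^+ 2.
    by move=> s0 st; rewrite lerXn2r ?nnegrE ?(ltW s0)// (le_trans (ltW s0)).
  have min0 : 0 < Num.min e1 e2 by rewrite lt_min e10.
  move=> x /= xe; split;
    rewrite /= (lt_le_trans xe)// lerD2l le_sqr// ge_min lexx ?orbT//.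
(* The parallelogram law makes the sublevel sets of [phi] small. *)
have close x y e : 0 < e -> phi x < m + e ^+ 2 -> phi y < m + e ^+ 2 ->
    rnorm (x - y) < 2 * e.
  move=> e0 xe ye.
  have := m_le ((2^-1)%:C%C *: (x + y)).
  move: xe ye; rewrite /phi fZ fD !rnorm_sqr rdotZl rdotZr !rdotDl !rdotDr (rdotC y x).
  move=> xe ye xy.
  rewrite -ltr_sqr ?nnegrE ?rnorm_ge0 ?mulr_ge0 ?ltW//.
  rewrite rnorm_sqr !rdotBl !rdotBr (rdotC y x).
  by lra.
have Fc : cauchy F.
  apply: cauchy_exP => d; rewrite ltcE /= => /andP[/eqP d0 d1].
  (* Radii live in [R[i]]; positivity forces [d] to be real. *)
  have -> : d = (complex.Re d)%:C%C by case: d d0 {d1} => u v /= ->.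
  set e := complex.Re d / 2.
  have e0 : 0 < e by rewrite divr_gt0.
  have [_ [x _ <-] xe] := inf_adherent (exprn_gt0 2 e0) phi_inf.
  exists x, e => // y /= ye; rewrite ball_rnorm.
  by have := close x y e e0 xe ye; rewrite /e mulrC divfK.
have Fz : F --> lim F by exact: cauchy_cvg.
move: (lim F) Fz => z Fz; exists z => h.
have approx e : 0 < e -> (f h - rdot h z) ^+ 2 <= 4 * rnorm h ^+ 2 * e ^+ 2.
  move=> e0.
  have Fze : F (ball z e%:C%C) by apply: Fz; apply: nbhsx_ballx; rewrite ltcR.
  have Fe : F [set x | phi x < m + e ^+ 2] by exists e.
  have [y [yz ye]] := filter_ex (filterI Fze Fe).
  have {yz} : rnorm (z - y) < e by rewrite -ball_rnorm.
  move=> yz.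
  (* Moving from [y] to [y + t h] changes [phi] by 2t(<h, y> - f h) + t^2 |h|^2, which is at least
     [- e ^+ 2] since [y] is that close to the infimum. *)
  have yh : (rdot h y - f h) ^+ 2 <= e ^+ 2 * rnorm h ^+ 2.
    apply: sqr_le_of_quadratic_ge => [|t]; first exact: sqr_ge0.
    have := m_le (y + t%:C%C *: h).
    move: ye; rewrite /phi /= fD fZ !rnorm_sqr rdotDl !rdotDr !rdotZl !rdotZr (rdotC y h).
    lra.
  have zy : (rdot h (z - y)) ^+ 2 <= e ^+ 2 * rnorm h ^+ 2.
    rewrite (le_trans (sqr_rdot_le _ _))// mulrC ler_wpM2r ?sqr_ge0//.
    by rewrite lerXn2r ?nnegrE ?rnorm_ge0// ltW// (le_lt_trans (rnorm_ge0 _) yz).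
  have -> : f h - rdot h z = - (rdot h (z - y) + (rdot h y - f h)).
    by rewrite rdotBr; ring.
  have := sqr_ge0 (rdot h (z - y) - (rdot h y - f h)); nra.
apply/eqP; rewrite -subr_eq0 -sqrf_eq0 eq_le sqr_ge0 andbT leNgt.
set s := (_ ^+ 2); apply/negP => s0.
(* The added 1 keeps the denominator positive when [h = 0], and makes [approx] contradictory for
   [e ^+ 2 = s / (4 * rnorm h ^+ 2 + 1)]. *)
have C0 : 0 < 4 * rnorm h ^+ 2 + 1 by rewrite ltr_wpDl// mulr_ge0 ?sqr_ge0.
have q0 : 0 < s / (4 * rnorm h ^+ 2 + 1) by rewrite divr_gt0.
have := approx (Num.sqrt (s / (4 * rnorm h ^+ 2 + 1))).
rewrite sqrtr_gt0 => /(_ q0); rewrite -/s sqr_sqrtr ?(ltW q0)// mulrA ler_pdivlMr//.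
nra.
Qed.

End riesz.

(** * Adjoints, real and imaginary parts, self-adjoint operators *)

Definition selfadjoint {R : realType} {H : hilbertType R} (T : H -> H) :=
  forall x y, inner (T x) y = inner x (T y).

Section operators.
Local Open Scope classical_set_scope.
Context {R : realType} {H : hilbertType R}.
Implicit Types (A S T : H -> H) (x y z u v : H) (M : R).

Lemma bounded_operator_le A : bounded_operator A ->
  exists2 M, 0 <= M & forall x, rnorm (A x) <= M * rnorm x.
Proof.
move=> [lA bA].
pose A' : {linear H -> H} := HB.pack A (GRing.isLinear.Build _ _ _ _ A lA).
have /linear_boundedP : bounded_near A' (nbhs 0) := bA.
move=> /pinfty_ex_gt0 [M M0 AM].
exists (complex.Re M); first by move: M0; rewrite ltcE => /andP[_ /ltW].
move=> x; have := AM x; rewrite !rnormE.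
have -> : M = (complex.Re M)%:C%C by rewrite RRe_real// gtr0_real.
by rewrite -rmorphM lecR.
Qed.

(** Once some representing vector exists, [get] returns one. Riesz matches the real parts; applying
    this to ['i%C *: u] matches the imaginary parts. *)
Lemma adjointP A : bounded_operator A ->
  forall x y, inner (A x) y = inner x (adjoint A y).
Proof.
move=> bA x y.
suff /getPex : exists z, [set z | forall x, inner (A x) y = inner x z] z by apply.
have [lA _] := bA; have [M M0 AM] := bounded_operator_le A bA.
have AD u v : A (u + v) = A u + A v by have := lA 1 u v; rewrite !scale1r.
have AZ k u : A (k *: u) = k *: A u := scalable_linear lA k u.
have [z fz] : exists z, forall x, rdot (A x) y = rdot x z.
  apply: (riesz_real _ (M * rnorm y)) => [u v|a u|u].
  - by rewrite AD rdotDl.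
  - by rewrite AZ rdotZl.
  - by rewrite mulrAC (le_trans (rdot_le _ _))// ler_wpM2r ?rnorm_ge0.
exists z => u; apply/eqP; rewrite eq_complex -/(rdot _ _) -/(rdot _ _) fz eqxx /=.
by rewrite !Im_inner_l -AZ fz.
Qed.

Lemma adjointPr A : bounded_operator A ->
  forall x y, inner (adjoint A x) y = inner x (A y).
Proof. by move=> bA x y; rewrite innerC -adjointP// -innerC. Qed.

Lemma adjoint_linear A : bounded_operator A -> linear (adjoint A).
Proof.
move=> bA k x y; apply: rdot_inj => z; rewrite /rdot; congr complex.Re.
by rewrite innerDr innerZr -!adjointP// innerDr innerZr.
Qed.

(** Cauchy-Schwarz gives |A^* x|^2 = <A A^* x, x> <= M |A^* x| |x|, and one factor |A^* x|
    cancels. *)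
Lemma adjoint_le A M : bounded_operator A ->
  (forall x, rnorm (A x) <= M * rnorm x) ->
  forall x, rnorm (adjoint A x) <= M * rnorm x.
Proof.
move=> bA AM x; have [->|z0] := eqVneq (rnorm (adjoint A x)) 0.
  exact: le_trans (rnorm_ge0 _) (AM x).
have zp : 0 < rnorm (adjoint A x) by rewrite lt_def z0 rnorm_ge0.
rewrite -(ler_pM2r zp) -expr2 rnorm_sqr /rdot -adjointP//.
rewrite (le_trans (ler_norm _))// (le_trans (rdot_le _ _))//.
by rewrite mulrAC ler_wpM2r ?rnorm_ge0.
Qed.

Lemma re_op_linear A : bounded_operator A -> linear (re_op A).
Proof.
move=> bA k x y; rewrite /re_op adjoint_linear// (proj1 bA).
rewrite scalerA (mulrC k) -scalerA -[RHS]scalerDr; congr (_ *: _).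
by rewrite scalerDr addrACA.
Qed.

Lemma im_op_linear A : bounded_operator A -> linear (im_op A).
Proof.
move=> bA k x y; rewrite /im_op adjoint_linear// (proj1 bA).
rewrite scalerA (mulrC k) -scalerA -[RHS]scalerDr; congr (_ *: _).
by rewrite scalerBr opprD addrACA.
Qed.

Lemma re_op_selfadjoint A : bounded_operator A -> selfadjoint (re_op A).
Proof.
move=> bA x y; rewrite /re_op innerZl innerZr innerDl innerDr adjointP// adjointPr//.
rewrite addrC; congr (_ * _); apply/esym.
by rewrite -[LHS]/(Num.conj _) rmorphV ?unitfE// rmorph_nat.
Qed.

Lemma im_op_selfadjoint A : bounded_operator A -> selfadjoint (im_op A).
Proof.
move=> bA x y; rewrite /im_op innerZl innerZr innerBl innerBr adjointP// adjointPr//.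
(* Passing to the adjoint reverses the difference; conjugating [(2 * 'i%C)^-1] supplies the
   compensating sign. *)
rewrite -opprB mulrN -mulNr; congr (_ * _).
rewrite -[RHS]/(Num.conj _) fmorphV rmorphM rmorph_nat /=.
have -> : Num.conj ('i%C : R[i]) = - 'i%C by apply/eqP; rewrite eq_complex /= oppr0 !eqxx.
by rewrite mulrN invrN.
Qed.

Lemma op_re_im A x : A x = re_op A x + 'i%C *: im_op A x.
Proof.
have i0 : 'i%C != 0 :> R[i] by rewrite eq_complex /= oner_eq0 andbF.
rewrite /re_op /im_op scalerA invfM mulrCA mulfV// mulr1 -scalerDr.
rewrite addrACA subrr addr0 -mulr2n -(scaler_nat 2 (A x)) scalerA mulVf ?scale1r//.
Qed.

(** The squares of [A] and of its adjoint cancel because [(2 * 'i%C)^-1] squares to -1/4; only the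
    mixed products survive. *)
Lemma adjoint_comp_re_im A x : bounded_operator A ->
  adjoint A (A x) + A (adjoint A x) =
  2 *: (re_op A (re_op A x) + im_op A (im_op A x)).
Proof.
move=> bA.
have lA := proj1 bA; have lA' := adjoint_linear A bA.
have ii : (2 * 'i%C : R[i])^-1 * (2 * 'i%C)^-1 = - (2^-1 * 2^-1).
  by rewrite -invfM mulrACA -!expr2 sqr_i mulrN1 invrN exprVn.
rewrite /re_op /im_op.
rewrite !(scalable_linear lA, scalable_linear lA').
rewrite !(zmod_morphism_linear lA, zmod_morphism_linear lA').
have AD T u v : linear T -> T (u + v) = T u + T v.
  by move=> lT; have := lT 1 u v; rewrite !scale1r.
rewrite !(AD _ _ _ lA, AD _ _ _ lA') -!scalerDr -!scalerBr !scalerA.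
rewrite ii scaleNr -scalerBr scalerA.
move: (A (A x)) (A (adjoint A x)) (adjoint A (A x)) (adjoint A (adjoint A x)) => a b c d.
rewrite (addrC a b) addrACA (opprB c d) [a - b + _]addrACA -opprD.
rewrite opprB (addrACA (b + c)) subrr addr0 -mulr2n -(scaler_nat 2 (b + c)) scalerA addrC.
have -> : 2 * (2^-1 / 2) * 2 = 1 :> R[i] by field.
by rewrite scale1r.
Qed.

Lemma selfadjoint_inner T x : selfadjoint T -> inner (T x) x = (rdot (T x) x)%:C%C.
Proof.
move=> sT; apply/eqP; rewrite eq_complex eqxx /=.
have := sT x x; rewrite [RHS]innerC.
by case: (inner (T x) x) => u v /= [vv]; apply/eqP; lra.
Qed.

(** Polarization: for y = Tx / |Tx|, 4 |Tx| = 4 Re <Tx, y> is the difference of the quadratic forms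
    at x + y and x - y, at most v (|x + y|^2 + |x - y|^2) = 4 v by the parallelogram law. *)
Lemma selfadjoint_le T (v : R) : linear T -> selfadjoint T ->
    (forall x, unit_sphere x -> `|rdot (T x) x| <= v) ->
  forall x, unit_sphere x -> rnorm (T x) <= v.
Proof.
move=> lT sT Tv x x1.
have TD u w : T (u + w) = T u + T w by have := lT 1 u w; rewrite !scale1r.
have TB u w : T (u - w) = T u - T w := zmod_morphism_linear lT u w.
have TZ k u : T (k *: u) = k *: T u := scalable_linear lT k u.
(* Homogeneity removes the normalization, as x + y and x - y need not be unit vectors. *)
have Tv' u : `|rdot (T u) u| <= v * rnorm u ^+ 2.
  have [->|u0] := eqVneq u 0.
    have -> : T 0 = 0 by have := TB 0 0; rewrite !subrr.
    by rewrite rnorm_sqr /rdot linear0r normr0 mulr0.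
  have := Tv _ (normalize_unit_sphere u u0).
  have u1 : 0 < rnorm u.
    by rewrite lt_def rnorm_ge0 andbT; apply: contra u0 => /eqP/rnorm_eq0 ->.
  rewrite TZ rdotZl rdotZr mulrA normrM -expr2 exprVn ger0_norm ?invr_ge0 ?sqr_ge0//.
  by rewrite mulrC ler_pdivrMr// exprn_gt0.
have [->|y0] := eqVneq (T x) 0.
  by rewrite /rnorm normr0; exact: le_trans (normr_ge0 _) (Tv x x1).
set y := (rnorm (T x))^-1%:C%C *: T x.
have y1 : unit_sphere y := normalize_unit_sphere _ y0.
have <- : rdot (T x) y = rnorm (T x).
  rewrite rdotZr -rnorm_sqr expr2 mulrA mulVf ?mul1r//.
  by apply: contra y0 => /eqP/rnorm_eq0 ->.
have Txy : rdot (T y) x = rdot (T x) y by rewrite rdotC /rdot sT.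
have := Tv' (x + y); have := Tv' (x - y).
rewrite TB TD !rnorm_sqr !(rdotBl, rdotBr, rdotDl, rdotDr) Txy (rdotC y x) -!rnorm_sqr.
rewrite !rnorm_unit_sphere// !ler_norml => /andP[? ?] /andP[? ?].
lra.
Qed.

End operators.

(** * Operator norm, Crawford number and numerical radius *)

Section numerical_radius.
Context {R : realType} {H : hilbertType R}.
Implicit Types (A S T : H -> H) (x y : H) (M : R).

Lemma op_norm_ge0 T : 0 <= op_norm T.
Proof.
rewrite /op_norm; set E := (X in sup X).
have E_ge0 (y : R) : E y -> 0 <= y by case=> x _ <-; exact: rnorm_ge0.
(* Without a supremum, [sup] takes the default value 0. *)
have [[[y Ey] ubE]|/sup_out ->//] := pselect (has_sup E).
exact: le_trans (E_ge0 _ Ey) (ub_le_sup ubE Ey).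
Qed.

Lemma crawford_number_ge0 T : 0 <= crawford_number T.
Proof.
rewrite /crawford_number; set E := (X in inf X).
have [->|/set0P E0] := eqVneq E set0; first by rewrite inf0.
by apply: lb_le_inf => // _ [x _ <-]; exact: rnorm_ge0.
Qed.

Lemma op_norm_le T M : 0 <= M ->
  (forall x, unit_sphere x -> rnorm (T x) <= M) -> op_norm T <= M.
Proof.
move=> M0 TM; rewrite /op_norm; set E := (X in sup X).
have [->|E0] := eqVneq E set0; first by rewrite sup0.
by apply: ge_sup; [exact/set0P|move=> _ [x x1 <-]; exact: TM].
Qed.

Lemma rnorm_le_op_norm T M x : (forall x, rnorm (T x) <= M * rnorm x) ->
  unit_sphere x -> rnorm (T x) <= op_norm T.
Proof.
move=> TM x1; apply: ub_le_sup; last by exists x.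
by exists M => _ [y y1 <-]; rewrite (le_trans (TM y))// rnorm_unit_sphere// mulr1.
Qed.

Lemma rnorm_le_op_normM T M x : linear T -> (forall x, rnorm (T x) <= M * rnorm x) ->
  rnorm (T x) <= op_norm T * rnorm x.
Proof.
move=> lT TM; have [->|x0] := eqVneq x 0.
  by rewrite (le_trans (TM 0))// /rnorm normr0 !mulr0.
have x1 : 0 < rnorm x.
  by rewrite lt_def rnorm_ge0 andbT; apply: contra x0 => /eqP/rnorm_eq0 ->.
have := rnorm_le_op_norm _ _ _ TM (normalize_unit_sphere x x0).
rewrite (scalable_linear lT) rnormZ rnorm_real ger0_norm ?invr_ge0 ?rnorm_ge0//.
by rewrite mulrC ler_pdivrMr.
Qed.

(** Stated for abstract [S] and [T] so as to apply to the real and imaginary parts in both orders.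
    The bound [M] makes the supremum defining [numerical_radius A] an actual upper bound. *)
Lemma op_norm_crawford_le A S T M : linear S -> selfadjoint S -> selfadjoint T ->
    (forall x, unit_sphere x -> rnorm (inner (A x) x) <= M) ->
    (forall x, rnorm (inner (A x) x) ^+ 2 = rdot (S x) x ^+ 2 + rdot (T x) x ^+ 2) ->
    (@unit_sphere R H !=set0)%classic ->
  op_norm S ^+ 2 + crawford_number T ^+ 2 <= numerical_radius A ^+ 2.
Proof.
move=> lS sS sT AM AST [x0 x01].
set c := crawford_number T; set w := numerical_radius A.
have c0 : 0 <= c := crawford_number_ge0 T.
have S_le x : unit_sphere x -> rdot (S x) x ^+ 2 <= w ^+ 2 - c ^+ 2.
  move=> x1.
  have cT : c <= `|rdot (T x) x|.
    apply: ge_inf; first by exists 0 => _ [y _ <-]; exact: rnorm_ge0.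
    by exists x => //; rewrite selfadjoint_inner// rnorm_real.
  have Aw : rnorm (inner (A x) x) <= w.
    by apply: ub_le_sup; [exists M => _ [y y1 <-]; exact: AM|exists x].
  rewrite lerBrDr.
  apply: (@le_trans _ _ (rnorm (inner (A x) x) ^+ 2)).
    rewrite AST lerD2l -(real_normK (num_real (rdot (T x) x))).
    by rewrite lerXn2r ?nnegrE.
  by rewrite lerXn2r ?nnegrE ?rnorm_ge0// (le_trans (rnorm_ge0 _) Aw).
(* A unit vector shows that the difference is nonnegative, so its square root can serve as the bound
   in [selfadjoint_le]. *)
have wc0 : 0 <= w ^+ 2 - c ^+ 2 by apply: le_trans (S_le _ x01); exact: sqr_ge0.
rewrite -lerBrDr -(sqr_sqrtr wc0) lerXn2r ?nnegrE ?op_norm_ge0 ?sqrtr_ge0//.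
apply: op_norm_le => [|x x1]; first exact: sqrtr_ge0.
apply: selfadjoint_le => // y y1.
by rewrite -sqrtr_sqr ler_wsqrtr// S_le.
Qed.

(** Self-adjointness makes both quadratic forms real, so they are the real and imaginary parts of
    <Ax, x>. *)
Lemma rnorm_inner_re_im A x : bounded_operator A ->
  rnorm (inner (A x) x) ^+ 2 = rdot (re_op A x) x ^+ 2 + rdot (im_op A x) x ^+ 2.
Proof.
move=> bA; rewrite (op_re_im A x) innerDl (innerZl 'i%C).
rewrite (selfadjoint_inner _ _ (re_op_selfadjoint A bA)).
rewrite (selfadjoint_inner _ _ (im_op_selfadjoint A bA)).
by rewrite rnorm_complex_sqr /=; congr (_ ^+ 2 + _ ^+ 2); ring.
Qed.

End numerical_radius.

Theorem theorem2p11 (R : realType) (H : hilbertType R) (A : H -> H)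
    (bA : bounded_operator A) :
  4^-1 * op_norm ((adjoint A \o A) \+ (A \o adjoint A))
    + (crawford_number (re_op A) ^+ 2 + crawford_number (im_op A) ^+ 2) / 2
    + `| (op_norm (re_op A) ^+ 2 - op_norm (im_op A) ^+ 2) / 2
         + (crawford_number (im_op A) ^+ 2 - crawford_number (re_op A) ^+ 2) / 2 |
  <= numerical_radius A ^+ 2.
Proof.
(* If the sphere is empty, every supremum and infimum is 0 and both sides vanish. *)
have [S0|/set0P Sne] := eqVneq (@unit_sphere R H) set0.
  rewrite /op_norm /crawford_number /numerical_radius S0 !image_set0 sup0 inf0.
  by rewrite expr0n /= addr0 subrr !mul0r mulr0 !addr0 normr0 addr0.
have [M M0 AM] := bounded_operator_le A bA.
have A'M := adjoint_le A M bA AM.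
have rM x : rnorm (re_op A x) <= M * rnorm x.
  rewrite /re_op rnormZ.
  have -> : rnorm (2^-1 : R[i]) = 2^-1.
    by apply: complexI; rewrite -rnormE fmorphV rmorph_nat normfV normr_nat.
  have := rnormD (A x) (adjoint A x); have := AM x; have := A'M x; lra.
have iM x : rnorm (im_op A x) <= M * rnorm x.
  rewrite /im_op rnormZ.
  have -> : rnorm ((2 * 'i%C)^-1 : R[i]) = 2^-1.
    apply: complexI; rewrite -rnormE fmorphV rmorph_nat normfV normrM normr_nat.
    by rewrite normc_def /= expr0n expr1n add0r sqrtr1 mulr1.
  have := rnormB (A x) (adjoint A x); have := AM x; have := A'M x; lra.
have lr := re_op_linear A bA; have li := im_op_linear A bA.
have sr := re_op_selfadjoint A bA; have si := im_op_selfadjoint A bA.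
(* A crude bound suffices for finiteness: the two squares add up to at most 2 M^2 <= (2 M)^2. *)
have Ab x : unit_sphere x -> rnorm (inner (A x) x) <= 2 * M.
  move=> x1.
  rewrite -ler_sqr ?nnegrE ?rnorm_ge0 ?mulr_ge0// rnorm_inner_re_im//.
  have le_sqr T : (forall x, rnorm (T x) <= M * rnorm x) -> rdot (T x) x ^+ 2 <= M ^+ 2.
    move=> TM; rewrite (le_trans (sqr_rdot_le _ _))//.
    have := TM x; rewrite (rnorm_unit_sphere x)// expr1n !mulr1 => Tx.
    by rewrite lerXn2r ?nnegrE ?rnorm_ge0.
  have := le_sqr _ rM; have := le_sqr _ iM; have := sqr_ge0 M; lra.
have w_re := op_norm_crawford_le A _ _ _ lr sr si Ab
  (fun x => rnorm_inner_re_im A x bA) Sne.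
have w_im : op_norm (im_op A) ^+ 2 + crawford_number (re_op A) ^+ 2
    <= numerical_radius A ^+ 2.
  apply: (op_norm_crawford_le A _ _ _ li si sr Ab _ Sne) => x.
  by rewrite rnorm_inner_re_im// addrC.
have AA : op_norm ((adjoint A \o A) \+ (A \o adjoint A))
    <= 2 * (op_norm (re_op A) ^+ 2 + op_norm (im_op A) ^+ 2).
  apply: op_norm_le => [|x x1].
    by rewrite mulr_ge0// addr_ge0// sqr_ge0.
  rewrite /= adjoint_comp_re_im// rnormZ.
  have -> : rnorm (2 : R[i]) = 2.
    by apply: complexI; rewrite -rnormE rmorph_nat normr_nat.
  have sq T : linear T -> (forall x, rnorm (T x) <= M * rnorm x) ->
      rnorm (T (T x)) <= op_norm T ^+ 2.
    move=> lT TM; rewrite (le_trans (rnorm_le_op_normM _ _ _ lT TM))// expr2.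
    by rewrite ler_wpM2l ?op_norm_ge0// (rnorm_le_op_norm _ _ _ TM).
  rewrite ler_pM2l// (le_trans (rnormD _ _))// lerD ?sq//.
(* After [AA], the two signs of the absolute value reduce the left side to those of [w_re] and
   [w_im]. *)
by rewrite -lerBrDl ler_norml; apply/andP; split; lra.
Qed.
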